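(* Let $\mathbf{SH}$ be any of the ten Smiley-Hanson systems $\mathbf{OK}$, $\mathbf{OM}$, $\mathbf{OS4}$, $\mathbf{OB}$, $\mathbf{OS5}$, $\mathbf{OK}^{+}$, $\mathbf{OM}^{+}$, $\mathbf{OS4}^{+}$, $\mathbf{OB}^{+}$, $\mathbf{OS5}^{+}$ of monadic deontic logic. Then for every formula $\phi$ of $\mathbf{L_1}$, $\vdash_{\mathbf{SH}} B^O(\phi)$ implies $\vdash_{\mathbf{L_1}} \phi$.
   Context: The system $\mathbf{L_1}$ (Leśniewski's propositional ontology): fix a countably infinite set of name variables. The atomic formulas are exactly the expressions $\epsilon ab$ with $a,b$ name variables (possibly equal); formulas are built from atomic formulas by $\vee$ and $\neg$, the other connectives being the usual classical abbreviations. $\mathbf{L_1}$ is a Hilbert-style system of classical propositional logic (with modus ponens) over these formulas with the additional axiom schemata, for all name variables $a,b,c$: (Ax1) $\epsilon ab \supset \epsilon aa$; (Ax2) $(\epsilon ab \wedge \epsilon bc) \supset \epsilon ac$; (Ax3) $(\epsilon ab \wedge \epsilon bc) \supset \epsilon ba$. Smiley-Hanson systems: formulas are those of propositional modal logic, built from propositional variables with $\top,\bot,\neg,\wedge,\vee,\rightarrow,\leftrightarrow$ and unary operators $O$ (obligation) and $P$ (permission). All systems have the rules modus ponens and $O$-necessitation (from $\vdash A$ infer $\vdash OA$). Axiom schemata: (A0) all classical propositional tautologies; (A1) $PA \leftrightarrow \neg O\neg A$; (A2) $O(A\rightarrow B)\rightarrow(OA\rightarrow OB)$; (A3) $OA\rightarrow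 PA$; (A4) $OA\rightarrow OOA$; (A5) $POA\rightarrow OA$; (A6) $O(OA\rightarrow A)$; (A7) $O(POA\rightarrow A)$. The systems are: $\mathbf{OK}$ = A0--A2; $\mathbf{OM}$ = A0--A2, A6; $\mathbf{OS4}$ = A0--A2, A4, A6; $\mathbf{OB}$ = A0--A2, A6, A7; $\mathbf{OS5}$ = A0--A2, A4, A5; and for each of these five systems $X$, $X^{+}$ is $X$ together with A3. The translation $B^O$: to each name variable $a$ corresponds a propositional variable $p_a$, with distinct name variables corresponding to distinct propositional variables. Then $B^O(\phi\vee\psi)=B^O(\phi)\vee B^O(\psi)$, $B^O(\neg\phi)=\neg B^O(\phi)$, and $B^O(\epsilon ab)= p_a\wedge O(p_a\supset p_b)\wedge\bigl(p_b\supset O(p_b\supset p_a)\bigr)$, where $\supset$ denotes (material) implication. *)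

(* Defs.v *)
From Stdlib Require Import Bool List.
Import ListNotations.

Definition name := nat.
Definition pvar := nat.

(** * The system L1 *)

Inductive lform : Type :=
| LEps (a b : name)
| LOr (A B : lform)
| LNeg (A : lform).

Definition LImp (A B : lform) : lform := LOr (LNeg A) B.
Definition LAnd (A B : lform) : lform := LNeg (LOr (LNeg A) (LNeg B)).

Fixpoint leval (v : name -> name -> bool) (A : lform) : bool :=
  match A with
  | LEps a b => v a b
  | LOr A B => leval v A || leval v B
  | LNeg A => negb (leval v A)
  end.

Definition ltautology (A : lform) : Prop :=
  forall v : name -> name -> bool, leval v A = true.

(** The classical propositional base is given by taking all tautologies as
    axioms, with modus ponens as the only rule. *)
Inductive L1_provable : lform -> Prop :=
| L1_taut (A : lform) : ltautology A -> L1_provable A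
| L1_ax1 (a b : name) : L1_provable (LImp (LEps a b) (LEps a a))
| L1_ax2 (a b c : name) :
    L1_provable (LImp (LAnd (LEps a b) (LEps b c)) (LEps a c))
| L1_ax3 (a b c : name) :
    L1_provable (LImp (LAnd (LEps a b) (LEps b c)) (LEps b a))
| L1_mp (A B : lform) :
    L1_provable (LImp A B) -> L1_provable A -> L1_provable B.

(** * Smiley-Hanson systems *)

Inductive mform : Type :=
| MVar (p : pvar)
| MTop
| MBot
| MNeg (A : mform)
| MAnd (A B : mform)
| MOr (A B : mform)
| MImp (A B : mform)
| MIff (A B : mform)
| Obl (A : mform)
| Perm (A : mform).

(** Truth-functional evaluation: formulas [Obl A] and [Perm A] are treated as
    atoms, so that [mtautology] singles out exactly the substitution instances
    of the tautologies of the non-modal language. *)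
Fixpoint meval (v : mform -> bool) (A : mform) : bool :=
  match A with
  | MVar _ | Obl _ | Perm _ => v A
  | MTop => true
  | MBot => false
  | MNeg A => negb (meval v A)
  | MAnd A B => meval v A && meval v B
  | MOr A B => meval v A || meval v B
  | MImp A B => implb (meval v A) (meval v B)
  | MIff A B => eqb (meval v A) (meval v B)
  end.

Definition mtautology (A : mform) : Prop :=
  forall v : mform -> bool, meval v A = true.

Inductive schema : Type := A0 | A1 | A2 | A3 | A4 | A5 | A6 | A7.

Inductive instance : schema -> mform -> Prop :=
| inst_A0 (A : mform) : mtautology A -> instance A0 A
| inst_A1 (A : mform) : instance A1 (MIff (Perm A) (MNeg (Obl (MNeg A))))
| inst_A2 (A B : mform) :
    instance A2 (MImp (Obl (MImp A B)) (MImp (Obl A) (Obl B)))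
| inst_A3 (A : mform) : instance A3 (MImp (Obl A) (Perm A))
| inst_A4 (A : mform) : instance A4 (MImp (Obl A) (Obl (Obl A)))
| inst_A5 (A : mform) : instance A5 (MImp (Perm (Obl A)) (Obl A))
| inst_A6 (A : mform) : instance A6 (Obl (MImp (Obl A) A))
| inst_A7 (A : mform) : instance A7 (Obl (MImp (Perm (Obl A)) A)).

Inductive SH_system : Type :=
| OK | OM | OS4 | OB | OS5
| OKplus | OMplus | OS4plus | OBplus | OS5plus.

Definition schemata (SH : SH_system) : list schema :=
  match SH with
  | OK => [A0; A1; A2]
  | OM => [A0; A1; A2; A6]
  | OS4 => [A0; A1; A2; A4; A6]
  | OB => [A0; A1; A2; A6; A7]
  | OS5 => [A0; A1; A2; A4; A5]
  | OKplus => [A0; A1; A2; A3]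
  | OMplus => [A0; A1; A2; A6; A3]
  | OS4plus => [A0; A1; A2; A4; A6; A3]
  | OBplus => [A0; A1; A2; A6; A7; A3]
  | OS5plus => [A0; A1; A2; A4; A5; A3]
  end.

Inductive SH_provable (SH : SH_system) : mform -> Prop :=
| SH_ax (s : schema) (A : mform) :
    In s (schemata SH) -> instance s A -> SH_provable SH A
| SH_mp (A B : mform) :
    SH_provable SH (MImp A B) -> SH_provable SH A -> SH_provable SH B
| SH_nec (A : mform) : SH_provable SH A -> SH_provable SH (Obl A).

(** * The translation, relative to an assignment [p] of propositional variables
    to name variables *)

Fixpoint BO (p : name -> pvar) (phi : lform) : mform :=
  match phi with
  | LEps a b =>
      MAnd (MAnd (MVar (p a)) (Obl (MImp (MVar (p a)) (MVar (p b)))))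
           (MImp (MVar (p b)) (Obl (MImp (MVar (p b)) (MVar (p a)))))
  | LOr A B => MOr (BO p A) (BO p B)
  | LNeg A => MNeg (BO p A)
  end.

(* Main.v *)
(** Every Smiley-Hanson system is sound for a world [w] seeing exactly the
    worlds of a nonempty cluster [C], where [w] itself need not belong to [C]:
    this frame is serial, transitive and Euclidean, and every world seen from
    somewhere lies in [C].  A valuation [v] of the atoms satisfying Ax1-Ax3 is turned
    into such a model: the cluster consists of names, [p_a] holds at a name [c]
    iff [v c a], and [p_a] holds at [w] iff [v a a].  Then [BO p phi] at [w]
    has the value of [phi] under [v].  Only the instances of Ax1-Ax3 over the
    names of [phi] matter, so that [phi] is a tautological consequence of
    finitely many axioms of L1. *)

Require Import Defs.
From Stdlib Require Import Bool List PeanoNat.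
Import ListNotations.

Section Cluster.

Variables (W : Type) (C : list W) (val : W -> pvar -> bool).

(** Every world sees exactly [C], so the modal clauses ignore [w] and no accessibility relation is
    carried along. *)
Fixpoint truth (w : W) (A : mform) : bool :=
  match A with
  | MVar q => val w q
  | MTop => true
  | MBot => false
  | MNeg A => negb (truth w A)
  | MAnd A B => truth w A && truth w B
  | MOr A B => truth w A || truth w B
  | MImp A B => implb (truth w A) (truth w B)
  | MIff A B => eqb (truth w A) (truth w B)
  | Obl A => forallb (fun c => truth c A) C
  | Perm A => existsb (fun c => truth c A) C
  end.

(** [truth w] is itself one of the valuations that [mtautology] ranges over, which settles A0. *)
Lemma meval_truth (w : W) (A : mform) : meval (truth w) A = truth w A.
Proof. induction A; simpl; congruence. Qed.

Lemma implb_intro (x y : bool) : (x = true -> y = true) -> implb x y = true.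
Proof. destruct x; auto. Qed.

Lemma implb_elim (x y : bool) : implb x y = true -> x = true -> y = true.
Proof. destruct x; [auto | discriminate]. Qed.

Lemma existsb_negb_forallb (T : Type) (f : T -> bool) (l : list T) :
  existsb f l = negb (forallb (fun x => negb (f x)) l).
Proof.
  induction l as [|x l IH]; simpl; [reflexivity|].
  rewrite IH. now destruct (f x).
Qed.

Lemma truth_perm_obl (w u : W) (A : mform) :
  truth w (Perm (Obl A)) = true -> truth u (Obl A) = true.
Proof. simpl. intros H. apply existsb_exists in H as (c & _ & H). exact H. Qed.

(** All eight schemata hold in the one frame, so the ten systems call for no case analysis. A3 rests
    on [c0]; A6 and A7 hold because their outer [Obl] inspects only worlds of [C], and these see
    themselves. *)
Lemma cluster_sound_instance (c0 : W) (s : schema) (A : mform) (w : W) :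
  In c0 C -> instance s A -> truth w A = true.
Proof.
  intros Hc0 H. destruct H as [A H|A|A B|A|A|A|A|A].
  - rewrite <- meval_truth. apply H.
  - simpl. rewrite existsb_negb_forallb. apply eqb_reflx.
  - simpl. apply implb_intro; intros HAB. apply implb_intro; intros HA.
    rewrite forallb_forall in *. intros c Hc.
    exact (implb_elim _ _ (HAB c Hc) (HA c Hc)).
  - apply implb_intro; simpl; intros HA. apply existsb_exists. exists c0.
    rewrite forallb_forall in HA. auto.
  - apply implb_intro; simpl; intros HA. apply forallb_forall. auto.
  - apply implb_intro. exact (truth_perm_obl w w A).
  - simpl. apply forallb_forall. intros c Hc. apply implb_intro; intros HA.
    rewrite forallb_forall in HA. auto.
  - apply forallb_forall. intros c Hc. apply implb_intro; intros HA.
    apply (truth_perm_obl c c) in HA. simpl in HA.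
    rewrite forallb_forall in HA. auto.
Qed.

Lemma cluster_sound (c0 : W) (SH : SH_system) (A : mform) :
  In c0 C -> SH_provable SH A -> forall w, truth w A = true.
Proof.
  intros Hc0 H.
  induction H as [s A _ H|A B _ IHAB _ IHA|A _ IH]; intros w.
  - eapply cluster_sound_instance; eassumption.
  - exact (implb_elim _ _ (IHAB w) (IHA w)).
  - simpl. apply forallb_forall. auto.
Qed.

End Cluster.

Fixpoint names (A : lform) : list name :=
  match A with
  | LEps a b => [a; b]
  | LOr A B => names A ++ names B
  | LNeg A => names A
  end.

Lemma names_nonempty (A : lform) : exists a, In a (names A).
Proof.
  induction A as [a b|A [a Ha] B _|A IH]; simpl.
  - exists a. now left.
  - exists a. apply in_or_app. now left.
  - exact IH.
Qed.

Lemma leval_ext (v v' : name -> name -> bool) (A : lform) :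
  (forall a b, In a (names A) -> In b (names A) -> v a b = v' a b) ->
  leval v A = leval v' A.
Proof.
  induction A as [a b|A IHA B IHB|A IH]; simpl; intros H.
  - apply H; auto.
  - rewrite IHA, IHB; auto using in_or_app.
  - now rewrite IH.
Qed.

Section Model.

Variables (p : name -> pvar) (v : name -> name -> bool) (l : list name).
Hypothesis p_inj : forall a b, p a = p b -> a = b.
Hypothesis v_right : forall a b, v a b = true -> In b l.
Hypothesis v_ax1 : forall a b, v a b = true -> v a a = true.
Hypothesis v_ax2 :
  forall a b c, v a b = true -> v b c = true -> v a c = true.
Hypothesis v_ax3 :
  forall a b c, v a b = true -> v b c = true -> v b a = true.

(* [None] is the distinguished world outside the cluster. *)
Definition name_val (w : option name) (q : pvar) : bool :=
  existsb (fun a => (p a =? q) && v (match w with Some c => c | None => a end) a) l.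

(** By injectivity of [p], the search in [name_val] can match only [a]; if [a] is not in [l], both
    sides are false by [v_right]. *)
Lemma name_val_p (w : option name) (a : name) :
  name_val w (p a) = v (match w with Some c => c | None => a end) a.
Proof.
  apply eq_iff_eq_true. unfold name_val. rewrite existsb_exists. split.
  - intros (b & _ & H). apply andb_true_iff in H as [Hb H].
    apply Nat.eqb_eq, p_inj in Hb. now subst b.
  - intros H. exists a. rewrite Nat.eqb_refl. eauto.
Qed.

Lemma truth_BO (A : lform) :
  truth _ (map Some l) name_val None (BO p A) = leval v A.
Proof.
  induction A as [a b|A IHA B IHB|A IH]; simpl; [|congruence|congruence].
  assert (obl_incl : forall x y,
    forallb (fun w => implb (name_val w (p x)) (name_val w (p y))) (map Some l)
      = true <->
    (forall c, In c l -> v c x = true -> v c y = true)).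
  { intros x y. rewrite forallb_forall. split.
    - intros H c Hc. specialize (H (Some c) (in_map Some _ _ Hc)).
      rewrite !name_val_p in H. exact (implb_elim _ _ H).
    - intros H w Hw. apply in_map_iff in Hw as (c & <- & Hc).
      rewrite !name_val_p. apply implb_intro. auto. }
  rewrite !name_val_p. apply eq_iff_eq_true.
  rewrite !andb_true_iff, obl_incl. split.
  (* [p_a] at [None] means [v a a], so [a] lies in [l] by [v_right], and the inclusion read at [a]
     gives [v a b]. *)
  - intros [[Ha Hab] _]. eauto.
  - intros Hab. split; [split|]; eauto.
    (* From [v a b] and [v b b], Ax3 gives [v b a]; Ax2 then takes [v c b] to [v c a]. *)
    apply implb_intro; intros Hb. apply obl_incl. eauto.
Qed.

End Model.

Definition axioms_over (l : list name) : list lform :=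
  flat_map (fun a => flat_map (fun b => flat_map (fun c =>
    [LImp (LEps a b) (LEps a a);
     LImp (LAnd (LEps a b) (LEps b c)) (LEps a c);
     LImp (LAnd (LEps a b) (LEps b c)) (LEps b a)]) l) l) l.

Lemma in_axioms_over (l : list name) (A : lform) :
  In A (axioms_over l) <->
  exists a b c, In a l /\ In b l /\ In c l /\
    (A = LImp (LEps a b) (LEps a a) \/
     A = LImp (LAnd (LEps a b) (LEps b c)) (LEps a c) \/
     A = LImp (LAnd (LEps a b) (LEps b c)) (LEps b a)).
Proof.
  unfold axioms_over. rewrite in_flat_map. setoid_rewrite in_flat_map.
  setoid_rewrite in_flat_map. simpl. split.
  - intros (a & Ha & b & Hb & c & Hc & H). exists a, b, c.
    intuition auto.
  - intros (a & b & c & Ha & Hb & Hc & H). exists a; split; [auto|].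
    exists b; split; [auto|]. exists c; split; [auto|]. intuition auto.
Qed.

Lemma L1_provable_axioms_over (l : list name) (A : lform) :
  In A (axioms_over l) -> L1_provable A.
Proof.
  rewrite in_axioms_over.
  intros (a & b & c & _ & _ & _ & [->|[->| ->]]);
    [apply L1_ax1 | apply L1_ax2 | apply (L1_ax3 a b c)].
Qed.

(** A tautological consequence of the finite list [G] becomes a single tautology, as [L1_taut]
    requires. *)
Lemma leval_fold_LImp (v : name -> name -> bool) (G : list lform) (A : lform) :
  ((forall B, In B G -> leval v B = true) -> leval v A = true) ->
  leval v (fold_right LImp A G) = true.
Proof.
  induction G as [|B G IH]; simpl; intros H.
  - apply H. intros ? [].
  - destruct (leval v B) eqn:HB; simpl; [|reflexivity].
    apply IH. intros HG. apply H. intros D [<-|HD]; auto.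
Qed.

Lemma L1_provable_fold_LImp (G : list lform) (A : lform) :
  (forall B, In B G -> L1_provable B) ->
  L1_provable (fold_right LImp A G) -> L1_provable A.
Proof.
  induction G as [|B G IH]; simpl; intros HG H; [exact H|].
  apply IH; [auto|]. apply L1_mp with B; auto.
Qed.

(** The axioms over [l] constrain [v] only at names in [l]. Making it false elsewhere yields Ax1-Ax3
    for all names, and [v_right] as well, without affecting formulas over [l]. *)
Definition restrict (l : list name) (v : name -> name -> bool)
    (a b : name) : bool :=
  existsb (Nat.eqb a) l && existsb (Nat.eqb b) l && v a b.

Lemma existsb_eqb_In (l : list name) (a : name) :
  existsb (Nat.eqb a) l = true <-> In a l.
Proof.
  rewrite existsb_exists. split.
  - intros (b & Hb & E). apply Nat.eqb_eq in E. now subst b.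
  - intros Ha. exists a. now rewrite Nat.eqb_refl.
Qed.

Lemma restrict_true (l : list name) (v : name -> name -> bool) (a b : name) :
  restrict l v a b = true <-> In a l /\ In b l /\ v a b = true.
Proof.
  unfold restrict. rewrite !andb_true_iff, !existsb_eqb_In. tauto.
Qed.

Lemma leval_LImp_LAnd (v : name -> name -> bool) (A B D : lform) :
  leval v (LImp (LAnd A B) D) = true ->
  leval v A = true -> leval v B = true -> leval v D = true.
Proof. simpl. intros H HA HB. now rewrite HA, HB in H. Qed.

Theorem theorem5p3 (p : name -> pvar)
  (p_inj : forall a b : name, p a = p b -> a = b)
  (SH : SH_system) (phi : lform) :
  SH_provable SH (BO p phi) -> L1_provable phi.
Proof.
  intros Hphi. set (l := names phi).
  apply L1_provable_fold_LImp with (G := axioms_over l);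
    [apply L1_provable_axioms_over|].
  apply L1_taut. intros v. apply leval_fold_LImp. intros Hax.
  rewrite (leval_ext v (restrict l v)).
  2:{ intros a b Ha Hb. apply eq_iff_eq_true. rewrite restrict_true.
      unfold l. tauto. }
  rewrite <- (truth_BO p (restrict l v) l p_inj).
  (* L1 has no propositional constants, so [phi] contains a name, and [Some a] makes the cluster
     nonempty. *)
  - destruct (names_nonempty phi) as [a Ha].
    apply (cluster_sound _ _ _ (Some a) SH); [now apply in_map | exact Hphi].
  - intros a b H. now apply restrict_true in H.
  - intros a b H. apply restrict_true in H as (Ha & Hb & H).
    apply restrict_true. repeat split; auto.
    assert (E : leval v (LImp (LEps a b) (LEps a a)) = true).
    { apply Hax, in_axioms_over. exists a, b, a. auto 6. }
    simpl in E. now rewrite H in E.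
  - intros a b c H H'. apply restrict_true in H as (Ha & Hb & H).
    apply restrict_true in H' as (_ & Hc & H').
    apply restrict_true. repeat split; auto.
    apply (leval_LImp_LAnd v (LEps a b) (LEps b c) (LEps a c)); auto.
    apply Hax, in_axioms_over. exists a, b, c. auto 7.
  - intros a b c H H'. apply restrict_true in H as (Ha & Hb & H).
    apply restrict_true in H' as (_ & Hc & H').
    apply restrict_true. repeat split; auto.
    apply (leval_LImp_LAnd v (LEps a b) (LEps b c) (LEps b a)); auto.
    apply Hax, in_axioms_over. exists a, b, c. auto 7.
Qed.
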